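(* Let $C$ be a nondegenerate closed curve in the affine plane $\mathbf{A}^2$ without affine inflection points. Let $k$ be its general-affine curvature and $\omega_s$ its general-affine length element. Then the total curvature $\int_C k\,\omega_s$ vanishes. In particular, $C$ has at least two general-affine flat points.
   Context: All curves are smooth. A parametrized curve $x=x(t)$ in $\mathbf{A}^2$ is nondegenerate if $x'$ and $x''$ are linearly independent at every point. A closed curve is a smooth curve parametrized by a circle. For a nondegenerate curve there exist a frame $e_1,e_2$ along $x$ (smooth, pointwise linearly independent vector fields along $x$, with $e_1$ a positive multiple of $dx/dt$), a $1$-form $\omega$ and a function $\ell$ such that $dx=\omega e_1$, $de_1=\omega e_2$, $de_2=-\ell\omega e_1$. These are unique up to $\tilde e_1=\lambda e_1$, $\tilde e_2=\lambda^2e_2$, $\tilde\omega=\lambda^{-1}\omega$, $\tilde\ell=\lambda^2\ell$ with a constant $\lambda>0$. A point where $\ell=0$ is an affine inflection point. Where $\ell\ne0$, put $\epsilon=\mathrm{sign}(\ell)=\pm1$. The general-affine length element is $\omega_s=\sqrt{\epsilon\ell}\,\omega$, and the general-affine curvature $k$ is the function defined by $d\ell/\ell=k\,\omega_s$. A general-affine flat point is a point where $k=0$. *)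

(* Defs.v *)
From Stdlib Require Import Reals.
From Coquelicot Require Import Coquelicot.
Open Scope R_scope.

Definition smooth (f : R -> R) : Prop := forall (n : nat) (t : R), ex_derive_n f n t.

(* Points and vectors of the affine plane A^2, in an affine coordinate system. *)
Definition plane : Type := (R * R)%type.

Definition smooth_path (v : R -> plane) : Prop :=
  smooth (fun t => fst (v t)) /\ smooth (fun t => snd (v t)).

Definition velocity (v : R -> plane) (t : R) : plane :=
  (Derive (fun u => fst (v u)) t, Derive (fun u => snd (v u)) t).

Definition lin_indep (u v : plane) : Prop :=
  forall a b : R, plus (scal a u) (scal b v) = zero -> a = 0 /\ b = 0.

Definition nondegenerate (x : R -> plane) : Prop :=
  smooth_path x /\ forall t : R, lin_indep (velocity x t) (velocity (velocity x) t).

(* A curve parametrized by the circle R / TZ, given by its lift to R; the curve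
   need not be simple. *)
Definition closed_curve (T : R) (x : R -> plane) : Prop :=
  0 < T /\ smooth_path x /\ forall t : R, x (t + T) = x t.

(* The 1-form is given by its coefficient w with respect to dt. The data live over
   the lifted parameter t in R; for a closed curve they are not assumed periodic. *)
Record affine_frame (x e1 e2 : R -> plane) (w l : R -> R) : Prop := {
  frame_smooth1 : smooth_path e1;
  frame_smooth2 : smooth_path e2;
  frame_smooth_form : smooth w;
  frame_smooth_fun : smooth l;
  frame_indep : forall t : R, lin_indep (e1 t) (e2 t);
  frame_tangent : forall t : R, exists c : R, 0 < c /\ e1 t = scal c (velocity x t);
  frame_dx : forall t : R, velocity x t = scal (w t) (e1 t);
  frame_de1 : forall t : R, velocity e1 t = scal (w t) (e2 t);
  frame_de2 : forall t : R, velocity e2 t = scal (- l t * w t) (e1 t)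
}.

Definition affine_inflection (l : R -> R) (t : R) : Prop := l t = 0.

(* Coefficient of the length element with respect to dt. *)
Definition ga_length_element (w l : R -> R) (t : R) : R :=
  sqrt (sign (l t) * l t) * w t.

Definition ga_curvature (w l k : R -> R) : Prop :=
  forall t : R, Derive l t / l t = k t * ga_length_element w l t.

Definition ga_flat (k : R -> R) (t : R) : Prop := k t = 0.

(* Main.v *)
Require Import Defs.
From Stdlib Require Import Reals Lra.
From Coquelicot Require Import Coquelicot.
Open Scope R_scope.

(** Where [l] has no zero, [k * ga_length_element w l] is the logarithmic
    derivative of [l], with primitive [ln (l^2) / 2]; its integral over a period
    vanishes as soon as [l] takes the same value at both ends.  The point is
    therefore that [l] is [T]-periodic, although the frame, given on the
    universal cover of the circle, is not assumed to be.  This follows by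
    recovering the frame from the curve: the structure equations make
    [det e1 e2] a nonzero constant, and give [det x' x'' = w^3 * det e1 e2]
    ([det_acceleration]).  The left side is periodic, hence so is [w^3], and so is
    [w] because cubing is injective.  Then [e1 = x'/w], [e2 = e1'/w] and finally
    [l], read off from [e2' = - l w e1], are periodic too ([frame_fun_periodic]).

    Since [k * ga_length_element w l = l'/l] with nonvanishing length element, the
    flat points are the critical points of [l].  A differentiable periodic
    function has two of them in a period, where it attains its maximum and its
    minimum ([periodic_two_critical_points]). *)

(** * Periodic functions of one variable *)

Definition periodic {A : Type} (T : R) (f : R -> A) : Prop :=
  forall t : R, f (t + T) = f t.

Lemma Derive_periodic (T : R) (f : R -> R) :
  periodic T f -> periodic T (Derive f).
Proof.
  intros Hf t. unfold Derive. f_equal. apply Lim_ext. intros h.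
  replace (t + T + h) with (t + h + T) by ring. now rewrite !Hf.
Qed.

(** Bounds pass from one period to an open interval around it, so that interior
    extremum theorems also apply at the endpoints of the period. *)
Lemma periodic_three_periods (T : R) (f : R -> R) (P : R -> Prop) :
  periodic T f -> (forall t, 0 <= t <= T -> P (f t)) ->
  forall t, - T < t < 2 * T -> P (f t).
Proof.
  intros Hf HP t Ht.
  destruct (Rlt_le_dec t 0) as [H0|H0].
  { rewrite <- Hf. apply HP. lra. }
  destruct (Rle_lt_dec t T) as [H1|H1].
  { apply HP. lra. }
  replace t with (t - T + T) by ring. rewrite Hf. apply HP. lra.
Qed.

Lemma smooth_ex_derive (f : R -> R) :
  smooth f -> forall t, ex_derive f t.
Proof. intros Hf t. exact (Hf 1%nat t). Qed.

(** The points sought are those where the maximum and the minimum over a period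
    are attained; if they coincide, the function is constant there and every
    point is critical. *)
Lemma periodic_two_critical_points (T : R) (f : R -> R) :
  0 < T -> (forall t, ex_derive f t) -> periodic T f ->
  exists t1 t2, 0 <= t1 /\ t1 < t2 /\ t2 < T /\ Derive f t1 = 0 /\ Derive f t2 = 0.
Proof.
  intros HT Hd Hf.
  assert (Hc : forall c, 0 <= c <= T -> continuity_pt f c).
  { intros c _. apply continuity_pt_filterlim.
    exact (ex_derive_continuous f c (Hd c)). }
  destruct (continuity_ab_maj f 0 T (Rlt_le _ _ HT) Hc) as [M [HM HMI]].
  destruct (continuity_ab_min f 0 T (Rlt_le _ _ HT) Hc) as [m [Hm HmI]].
  pose proof (periodic_three_periods T f (fun y => y <= f M) Hf HM) as HM3.
  pose proof (periodic_three_periods T f (fun y => f m <= y) Hf Hm) as Hm3.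
  cbv beta in HM3, Hm3.
  assert (DM : forall c, 0 <= c <= T -> f c = f M -> Derive f c = 0).
  { intros c Hcc E.
    rewrite <- (Derive_Reals f c (ex_derive_Reals_0 f c (Hd c))).
    apply (deriv_maximum f (- T) (2 * T)); try lra.
    intros t Ht1 Ht2. rewrite E. apply HM3. lra. }
  assert (Dm : forall c, 0 <= c <= T -> f c = f m -> Derive f c = 0).
  { intros c Hcc E.
    rewrite <- (Derive_Reals f c (ex_derive_Reals_0 f c (Hd c))).
    apply (deriv_minimum f (- T) (2 * T)); try lra.
    intros t Ht1 Ht2. rewrite E. apply Hm3. lra. }
  (* An extremum attained at [T] is attained at [0] as well. *)
  assert (Hmod : forall c, 0 <= c <= T -> exists d, 0 <= d < T /\ f d = f c).
  { intros c Hcc. destruct (Rlt_le_dec c T) as [H|H].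
    - exists c. split; [lra | reflexivity].
    - exists 0. split; [lra |]. rewrite <- (Hf 0). f_equal. lra. }
  destruct (Hmod M HMI) as [a [Ha Ea]].
  destruct (Hmod m HmI) as [b [Hb Eb]].
  destruct (Rtotal_order a b) as [H|[H|H]].
  - exists a, b. repeat split; try lra.
    + apply DM; [lra | exact Ea].
    + apply Dm; [lra | exact Eb].
  - assert (Hcst : f M = f m) by now rewrite <- Ea, <- Eb, H.
    exists 0, (T / 2). repeat split; try lra; apply DM; try lra;
      (apply Rle_antisym; [apply HM | rewrite Hcst; apply Hm]; lra).
  - exists b, a. repeat split; try lra.
    + apply Dm; [lra | exact Eb].
    + apply DM; [lra | exact Ea].
Qed.

Lemma is_RInt_logarithmic_derivative (f : R -> R) (a b : R) :
  smooth f -> (forall t, f t <> 0) ->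
  is_RInt (fun t => Derive f t / f t) a b
    (ln (f b * f b) / 2 - ln (f a * f a) / 2).
Proof.
  intros Hs Hn.
  apply (is_RInt_derive (fun t => ln (f t * f t) / 2)).
  - intros t _. pose proof (Hn t) as Ht.
    auto_derive.
    + repeat split; try (now apply smooth_ex_derive).
      nra.
    + change (fun x : R => f x) with f. field. exact Ht.
  - intros t _.
    apply (ex_derive_continuous (fun u => Derive f u / f u)).
    apply ex_derive_div; [exact (Hs 2%nat t) | now apply smooth_ex_derive | apply Hn].
Qed.

(** * Determinants and adapted frames *)

Definition det (u v : plane) : R := fst u * snd v - snd u * fst v.

Lemma lin_indep_det_neq0 (u v : plane) : lin_indep u v -> det u v <> 0.
Proof.
  intros H D. unfold det in D.
  destruct u as [u1 u2], v as [v1 v2]; simpl in D.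
  assert (E : forall a b, a * u1 + b * v1 = 0 -> a * u2 + b * v2 = 0 ->
                a = 0 /\ b = 0).
  { intros a b H1 H2. apply H. apply injective_projections; assumption. }
  (* Cramer's rule makes the cofactors the coefficients of linear relations. *)
  destruct (E v2 (- u2)) as [V2 U2]; try lra.
  destruct (E (- v1) u1) as [V1 U1]; try lra.
  destruct (E 1 0) as [E1 _]; try lra; subst; lra.
Qed.

Lemma scal_inj_plane (c : R) (u v : plane) :
  c <> 0 -> scal c u = scal c v -> u = v.
Proof.
  intros Hc E.
  apply injective_projections; apply (Rmult_eq_reg_l c); try exact Hc.
  - exact (f_equal fst E).
  - exact (f_equal snd E).
Qed.

Lemma velocity_periodic (T : R) (v : R -> plane) :
  periodic T v -> periodic T (velocity v).
Proof.
  intros Hv t. unfold velocity. f_equal; apply Derive_periodic; intros u; now rewrite Hv.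
Qed.

Section Frame.

Variables (T : R) (x e1 e2 : R -> plane) (w l : R -> R).
Hypothesis Hframe : affine_frame x e1 e2 w l.

(** [e1] is a positive multiple of [x'] and [x' = w e1], so [w] is the inverse of
    that multiple. *)
Lemma frame_form_pos (t : R) : 0 < w t.
Proof using Hframe.
  destruct (frame_tangent _ _ _ _ _ Hframe t) as [c [Hc E]].
  rewrite (frame_dx _ _ _ _ _ Hframe t) in E.
  destruct (frame_indep _ _ _ _ _ Hframe t (1 - c * w t) 0) as [H _].
  - apply (f_equal fst) in E as E1. apply (f_equal snd) in E as E2.
    cbn in E1, E2. unfold mult in E1, E2; cbn in E1, E2.
    apply injective_projections; cbn; unfold mult; cbn; lra.
  - assert (0 < c * w t) by lra. nra.
Qed.

Lemma frame_derivatives (t : R) :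
  (Derive (fun u => fst (e1 u)) t = w t * fst (e2 t) /\
   Derive (fun u => snd (e1 u)) t = w t * snd (e2 t)) /\
  (Derive (fun u => fst (e2 u)) t = - l t * w t * fst (e1 t) /\
   Derive (fun u => snd (e2 u)) t = - l t * w t * snd (e1 t)).
Proof using Hframe.
  pose proof (frame_de1 _ _ _ _ _ Hframe t) as H1.
  pose proof (frame_de2 _ _ _ _ _ Hframe t) as H2.
  repeat split.
  - exact (f_equal fst H1).
  - exact (f_equal snd H1).
  - exact (f_equal fst H2).
  - exact (f_equal snd H2).
Qed.

(** [e1'] is parallel to [e2] and [e2'] to [e1], so both terms of the derivative
    of the determinant vanish. *)
Lemma frame_det_const (s t : R) : det (e1 s) (e2 s) = det (e1 t) (e2 t).
Proof using Hframe.
  destruct (frame_smooth1 _ _ _ _ _ Hframe) as [S11 S12].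
  destruct (frame_smooth2 _ _ _ _ _ Hframe) as [S21 S22].
  assert (D : forall u, is_derive (fun u => det (e1 u) (e2 u)) u 0).
  { intros u. destruct (frame_derivatives u) as [[D1 D2] [D3 D4]].
    apply smooth_ex_derive with (t := u), Derive_correct in S11, S12, S21, S22.
    rewrite D1 in S11. rewrite D2 in S12. rewrite D3 in S21. rewrite D4 in S22.
    pose proof (is_derive_minus _ _ _ _ _
      (is_derive_mult _ _ _ _ _ S11 S22 Rmult_comm)
      (is_derive_mult _ _ _ _ _ S12 S21 Rmult_comm)) as D.
    match type of D with is_derive _ _ ?d => replace 0 with d end; [exact D |].
    cbn; unfold mult; cbn. ring. }
  destruct (MVT_gen (fun u => det (e1 u) (e2 u)) s t (fun _ => 0)) as [c [_ E]].
  - intros u _. apply D.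
  - intros u _. apply continuity_pt_filterlim.
    apply (ex_derive_continuous (fun u => det (e1 u) (e2 u))). eexists; apply D.
  - lra.
Qed.

(** Up to a multiple of [e1], the acceleration [x'' = w' e1 + w e1'] is [w^2 e2]. *)
Lemma det_acceleration (t : R) :
  det (velocity x t) (velocity (velocity x) t) = w t ^ 3 * det (e1 t) (e2 t).
Proof using Hframe.
  destruct (frame_smooth1 _ _ _ _ _ Hframe) as [S11 S12].
  pose proof (smooth_ex_derive _ (frame_smooth_form _ _ _ _ _ Hframe) t) as Sw.
  destruct (frame_derivatives t) as [[D1 D2] _].
  unfold velocity at 2.
  rewrite (Derive_ext (fun u => fst (velocity x u)) (fun u => w u * fst (e1 u)))
    by (intros u; now rewrite (frame_dx _ _ _ _ _ Hframe u)).
  rewrite (Derive_ext (fun u => snd (velocity x u)) (fun u => w u * snd (e1 u)))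
    by (intros u; now rewrite (frame_dx _ _ _ _ _ Hframe u)).
  rewrite !Derive_mult by (assumption || now apply smooth_ex_derive).
  rewrite D1, D2, (frame_dx _ _ _ _ _ Hframe t).
  unfold det; cbn; unfold mult; cbn. ring.
Qed.

Hypothesis Hx : periodic T x.

Lemma frame_form_periodic : periodic T w.
Proof using Hframe Hx.
  intros t.
  pose proof (velocity_periodic _ _ Hx) as Hv.
  pose proof (det_acceleration (t + T)) as E.
  rewrite (velocity_periodic _ _ Hv), Hv, (frame_det_const (t + T) t),
    det_acceleration in E.
  apply Rmult_eq_reg_r in E.
  2: apply lin_indep_det_neq0; exact (frame_indep _ _ _ _ _ Hframe t).
  pose proof (frame_form_pos t) as P. pose proof (frame_form_pos (t + T)) as Q.
  (* [a^3 - b^3 = (a - b) (a^2 + a b + b^2)], and the second factor is positive. *)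
  assert (F : (w (t + T) - w t) *
              (w (t + T) ^ 2 + w (t + T) * w t + w t ^ 2) = 0) by lra.
  apply Rmult_integral in F. destruct F as [F|F]; [lra | nra].
Qed.

Lemma frame_e1_periodic : periodic T e1.
Proof using Hframe Hx.
  intros t. apply (scal_inj_plane (w t)).
  { apply Rgt_not_eq, frame_form_pos. }
  rewrite <- frame_form_periodic at 1.
  rewrite <- !(frame_dx _ _ _ _ _ Hframe). apply velocity_periodic, Hx.
Qed.

Lemma frame_e2_periodic : periodic T e2.
Proof using Hframe Hx.
  intros t. apply (scal_inj_plane (w t)).
  { apply Rgt_not_eq, frame_form_pos. }
  rewrite <- frame_form_periodic at 1.
  rewrite <- !(frame_de1 _ _ _ _ _ Hframe). apply velocity_periodic, frame_e1_periodic.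
Qed.

Lemma frame_fun_periodic : periodic T l.
Proof using Hframe Hx.
  intros t.
  pose proof (velocity_periodic _ _ frame_e2_periodic t) as E.
  rewrite !(frame_de2 _ _ _ _ _ Hframe), frame_form_periodic, frame_e1_periodic in E.
  apply (f_equal fst) in E as E1. apply (f_equal snd) in E as E2.
  cbn in E1, E2. unfold mult in E1, E2; cbn in E1, E2.
  destruct (frame_indep _ _ _ _ _ Hframe t ((l (t + T) - l t) * w t) 0) as [H _].
  - apply injective_projections; cbn; unfold mult; cbn; lra.
  - pose proof (frame_form_pos t) as P.
    apply Rmult_integral in H. lra.
Qed.

End Frame.

(** * Total curvature and flat points *)

Lemma ga_flat_critical (w l k : R -> R) (t : R) :
  ga_curvature w l k -> 0 < w t -> l t <> 0 -> Derive l t = 0 -> ga_flat k t.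
Proof.
  intros Hk Hw Hl D. specialize (Hk t).
  rewrite D in Hk. unfold Rdiv in Hk. rewrite Rmult_0_l in Hk.
  symmetry in Hk. apply Rmult_integral in Hk. destruct Hk as [Hk|Hk]; [exact Hk |].
  exfalso. revert Hk. apply Rgt_not_eq, Rmult_lt_0_compat; [| exact Hw].
  apply sqrt_lt_R0.
  destruct (Rtotal_order (l t) 0) as [H|[H|H]].
  - rewrite sign_eq_m1 by exact H. lra.
  - contradiction.
  - rewrite sign_eq_1 by exact H. lra.
Qed.

Theorem corollary2p7 (T : R) (x e1 e2 : R -> plane) (w l k : R -> R)
    (hclosed : closed_curve T x)
    (hnondeg : nondegenerate x)
    (hframe : affine_frame x e1 e2 w l)
    (hinfl : forall t : R, ~ affine_inflection l t)
    (hk : ga_curvature w l k) :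
  is_RInt (fun t : R => k t * ga_length_element w l t) 0 T 0 /\
  exists t1 t2 : R,
    0 <= t1 /\ t1 < t2 /\ t2 < T /\ ga_flat k t1 /\ ga_flat k t2.
Proof.
  destruct hclosed as [HT [_ Hx]].
  pose proof (frame_fun_periodic T _ _ _ _ _ hframe Hx) as Hl.
  pose proof (frame_smooth_fun _ _ _ _ _ hframe) as Sl.
  split.
  - apply (is_RInt_ext (fun t => Derive l t / l t)); [intros t _; apply hk |].
    pose proof (is_RInt_logarithmic_derivative l 0 T Sl hinfl) as I.
    replace (l T) with (l 0) in I by (rewrite <- (Hl 0); f_equal; ring).
    rewrite Rminus_diag in I. exact I.
  - destruct (periodic_two_critical_points T l HT (smooth_ex_derive l Sl) Hl)
      as [t1 [t2 [H0 [H12 [HT2 [D1 D2]]]]]].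
    exists t1, t2. repeat split; try assumption;
      apply (ga_flat_critical w l);
      try assumption; try apply hinfl; exact (frame_form_pos _ _ _ _ _ hframe _).
Qed.
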